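(* Let $P$ be a Poisson algebra over an arbitrary field $F$ (of any characteristic, with no finite-dimensionality assumption). Then $P$ is a Dedekind Poisson algebra if and only if it is of one of the following two types. (I) $P=E\oplus Z$, a direct sum of vector spaces, where $Z$ is a zero Poisson algebra, either $E=0$ or $E=Fe$ with $e\neq 0$, $e^2=e$, and all Lie brackets on $P$ are zero (the only possibly non-zero product being $e^2=e$; in particular $eZ=0$). (II) $P=E\oplus Z\oplus V\oplus Fc$, a direct sum of vector spaces, with $V\neq 0$, $Fc$ one-dimensional with $c\neq 0$, either $E=0$ or $E=Fe$ with $e\neq0$, $e^2=e$, and there exist a symmetric bilinear form $\beta:V\times V\to F$ and an alternating bilinear form $\omega:V\times V\to F$ such that $$\beta(v,v)\neq 0\quad\text{for every } 0\neq v\in V,$$ and the only possibly non-zero operations besides $e^2=e$ are $$uv=\beta(u,v)c,\qquad [u,v]=\omega(u,v)c\qquad (u,v\in V).$$ In particular, $ZP=Fc\,P=0$ and $[Z,P]=[c,P]=[e,P]=0$ (omitting $e$ when $E=0$). Conversely, every algebra of type (I) or (II) is a Dedekind Poisson algebra (in particular, such multiplication tables do define Poisson algebras).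
   Context: A Poisson algebra over a field $F$ is an $F$-vector space $P$ with a bilinear commutative associative multiplication $(x,y)\mapsto xy$ (no identity element is assumed) and a Lie bracket $[\,,\,]$ which is alternating ($[x,x]=0$ for all $x$, also in characteristic $2$), satisfying the Leibniz identity $[xy,z]=x[y,z]+y[x,z]$. A Poisson subalgebra is a vector subspace $H$ with $HH\subseteq H$ and $[H,H]\subseteq H$ (it need not contain an identity even if $P$ has one). A Poisson ideal is a vector subspace $I$ with $PI\subseteq I$ and $[P,I]\subseteq I$. A Poisson algebra is called Dedekind if every Poisson subalgebra of it is a Poisson ideal. A zero Poisson algebra is a vector space on which both multiplications are identically zero. A bilinear form $\omega$ on $V$ is alternating if $\omega(v,v)=0$ for all $v\in V$. In the multiplication tables, all products and brackets not displayed or forced by bilinearity, commutativity of the associative multiplication and alternation of the bracket are zero. *)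

(* Defs.v *)
From mathcomp Require Import all_boot all_algebra sesquilinear.
From mathcomp Require Import boolp classical_sets.

Set Implicit Arguments.
Unset Strict Implicit.
Unset Printing Implicit Defensive.

Import GRing.Theory.
Local Open Scope classical_set_scope.
Local Open Scope ring_scope.

Section Poisson.
Variables (F : fieldType) (P : lmodType F).

Definition alternating (br : P -> P -> P) := forall x, br x x = 0.

Definition jacobi (br : P -> P -> P) :=
  forall x y z, br x (br y z) + br y (br z x) + br z (br x y) = 0.

Definition leibniz (mul br : P -> P -> P) :=
  forall x y z, br (mul x y) z = mul x (br y z) + mul y (br x z).

Definition poisson (mul br : {bilinear P -> P -> P}) :=
  [/\ commutative mul, associative mul, alternating br, jacobi br
    & leibniz mul br].

Definition subspace (A : set P) := submod_closed [in A].

Definition poisson_subalgebra (mul br : P -> P -> P) (H : set P) :=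
  [/\ subspace H,
      forall x y, H x -> H y -> H (mul x y)
    & forall x y, H x -> H y -> H (br x y)].

Definition poisson_ideal (mul br : P -> P -> P) (I : set P) :=
  [/\ subspace I,
      forall x y, I y -> I (mul x y)
    & forall x y, I y -> I (br x y)].

Definition dedekind (mul br : P -> P -> P) :=
  forall H, poisson_subalgebra mul br H -> poisson_ideal mul br H.

Definition line (x : P) : set P := [set a *: x | a in [set: F]].

Definition direct_sum2 (A B : set P) :=
  forall x, exists! p : P * P,
    let: (a, b) := p in [/\ A a, B b & x = a + b].

Definition direct_sum4 (A B C D : set P) :=
  forall x, exists! p : P * P * P * P,
    let: (a, b, c, d) := p in [/\ A a, B b, C c, D d & x = a + b + c + d].

(* A bilinear form on a subspace V is a function on P of which only the values *)
(* on V x V matter.                                                            *)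
Definition bilinear_on (V : set P) (f : P -> P -> F) :=
  forall (a : F) u v w, V u -> V v -> V w ->
    f (a *: u + v) w = a * f u w + f v w /\
    f w (a *: u + v) = a * f w u + f w v.

Definition symmetric_on (V : set P) (f : P -> P -> F) :=
  forall u v, V u -> V v -> f u v = f v u.

Definition alternating_on (V : set P) (f : P -> P -> F) :=
  forall v, V v -> f v v = 0.

Definition anisotropic_on (V : set P) (f : P -> P -> F) :=
  forall v, V v -> v != 0 -> f v v != 0.

Definition vanish (op : P -> P -> P) (A B : set P) :=
  forall x y, A x -> B y -> op x y = 0.

(* The case E = 0 is recorded by e = 0, so that the table entry e e = e can be *)
(* written uniformly.                                                          *)
Definition zero_or_line (E : set P) (e : P) :=
  (e = 0 /\ E = [set 0]) \/ (e != 0 /\ E = line e).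

Definition decomposition_I (E Z : set P) (e : P) :=
  [/\ zero_or_line E e, subspace Z & direct_sum2 E Z].

(* In the tables, the products obtained from the listed ones by commutativity  *)
(* or alternation are left implicit: the tables are used together with these   *)
(* two laws.                                                                   *)
Definition table_I (mul br : P -> P -> P) (Z : set P) (e : P) :=
  [/\ mul e e = e, vanish mul Z setT & vanish br setT setT].

Definition type_I (mul br : P -> P -> P) :=
  exists E Z e, decomposition_I E Z e /\ table_I mul br Z e.

Definition decomposition_II (E Z V : set P) (e c : P) :=
  [/\ zero_or_line E e, subspace Z, subspace V /\ V <> [set 0], c != 0
    & direct_sum4 E Z V (line c)].

Definition forms_II (V : set P) (beta omega : P -> P -> F) :=
  [/\ bilinear_on V beta /\ symmetric_on V beta,
      bilinear_on V omega /\ alternating_on V omega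
    & anisotropic_on V beta].

Definition table_II (mul br : P -> P -> P) (E Z V : set P) (e c : P)
    (beta omega : P -> P -> F) :=
  [/\ mul e e = e,
      forall u v, V u -> V v -> mul u v = beta u v *: c,
      forall u v, V u -> V v -> br u v = omega u v *: c,
      [/\ vanish mul Z setT, vanish mul (line c) setT & vanish mul E V]
    & [/\ vanish br Z setT, vanish br (line c) setT & vanish br E setT]].

Definition type_II (mul br : P -> P -> P) :=
  exists E Z V e c beta omega,
    [/\ decomposition_II E Z V e c, forms_II V beta omega
      & table_II mul br E Z V e c beta omega].

End Poisson.

(* Main.v *)
Require Import Defs.
From HB Require Import structures.
From mathcomp Require Import all_boot all_algebra sesquilinear.
From mathcomp Require Import boolp classical_sets.
From mathcomp Require Import ring.

Set Implicit Arguments.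
Unset Strict Implicit.
Unset Printing Implicit Defensive.

Import GRing.Theory.
Local Open Scope classical_set_scope.
Local Open Scope ring_scope.

(** Type (I) and type (II) algebras both have a normal form
    [x y = eps(x) eps(y) e + beta(x, y) c], [[x, y] = omega(x, y) c], where [e]
    acts as [e x = eps(x) e] and [c] annihilates everything. All double products
    then reduce to the idempotent part, which gives the Poisson identities. If
    [x] lies in a subalgebra [H], then so do [x^3 = eps(x)^3 e] and
    [x^2 - eps(x)^2 e = beta(x, x) c]; by anisotropy these provide every vector
    that occurs in [P x] and [[P, x]], so [H] is an ideal
    ([normal_form_dedekind]). The tables are realised by taking this normal form
    as a definition, the coordinates being read off the direct sum
    ([exists_coordinates]).

    Conversely let [P] be Dedekind. Every subspace that is closed under products
    and on which the bracket vanishes is an ideal; applied to the line of an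
    idempotent this shows that [P] has at most one nonzero idempotent [e]
    ([idempotent_unique]), that [e] is central for the bracket and that
    [P = F e + N], where [N] is the annihilator of [e]; when there is no nonzero
    idempotent, [e = 0] and [N = P]. As [N] contains no nonzero idempotent,
    [x^3 = 0] for all [x] in [N] ([cube_eq0]): otherwise the ideal property for
    a small subalgebra containing [x^2] would produce one among the multiples of
    [x]. Then [F x + F x^2] is an ideal, and nilpotency sharpens this to
    [N x <= F x^2] and [[N, x] <= F x^2] ([mul_in_sq], [br_in_sq]). If
    [x0^2 <> 0], all squares in [N] are multiples of [c = x0^2]
    ([sq_proportional]), so products and brackets on [N] are given by forms with
    values in [F c]. The elements of [N] of square zero are annihilated by
    everything; choosing a complement [Z] of [F c] among them and a complement
    [V] of all of them in [N] gives type (II), anisotropy on [V] being the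
    statement that [V] contains no nonzero element of square zero. If all
    squares in [N] vanish, so do all operations on [N], which is type (I). *)

(** * Subspaces, complements and coordinates *)

Section Subspaces.
Variables (F : fieldType) (P : lmodType F).
Implicit Types (a b k : F) (x y z : P) (A B C D E Z V : set P).

Lemma scaler_coef_inj x a b : x != 0 -> a *: x = b *: x -> a = b.
Proof.
move=> x0 /eqP; rewrite -subr_eq0 -scalerBl scaler_eq0 (negPf x0) orbF subr_eq0.
by move/eqP.
Qed.

Lemma subspaceP A :
  subspace A <-> A 0 /\ forall a x y, A x -> A y -> A (a *: x + y).
Proof.
split=> [[A0 AP]|[A0 AP]].
  split=> [|a x y Ax Ay]; first by move: A0; rewrite inE.
  by have := AP a x y; rewrite !inE; apply.
by split=> [|a x y]; rewrite !inE //; apply: AP.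
Qed.

Lemma subspace0 A : subspace A -> A 0.
Proof. by case/subspaceP. Qed.

Lemma subspaceZ A a x : subspace A -> A x -> A (a *: x).
Proof. by case/subspaceP=> A0 AP Ax; rewrite -[_ *: _]addr0; apply: AP. Qed.

Lemma subspaceD A x y : subspace A -> A x -> A y -> A (x + y).
Proof. by case/subspaceP=> A0 AP Ax Ay; rewrite -[x]scale1r; apply: AP. Qed.

Lemma subspaceN A x : subspace A -> A x -> A (- x).
Proof. by move=> sA Ax; rewrite -scaleN1r; apply: subspaceZ. Qed.

Lemma subspaceB A x y : subspace A -> A x -> A y -> A (x - y).
Proof. by move=> sA Ax Ay; apply: subspaceD => //; apply: subspaceN. Qed.

Lemma subspace_line x : subspace (line x).
Proof.
apply/subspaceP; split=> [|a _ _ [k _ <-] [l _ <-]].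
  by exists 0; rewrite ?scale0r.
by exists (a * k + l); rewrite // scalerDl scalerA.
Qed.

Lemma subspace_set0 : subspace [set 0 : P].
Proof. by apply/subspaceP; split=> // a x y /= -> ->; rewrite scaler0 addr0. Qed.

Lemma line0 : line (0 : P) = [set 0].
Proof.
apply/seteqP; split=> [_ [a _ <-]|x ->] /=; first by rewrite scaler0.
by exists 0; rewrite ?scaler0.
Qed.

Lemma zero_or_lineE E e : zero_or_line E e -> E = line e.
Proof. by case=> [[-> ->]|[]//]; rewrite line0. Qed.

Lemma line_id x : line x x.
Proof. by exists 1; rewrite ?scale1r. Qed.

(** A complement of [A] in [B] is a subspace of [B] that is maximal among those
    meeting [A] trivially: were [x] in [B] outside [A + C], then [C + F x] would
    still meet [A] trivially. Closure under [a *: x + y] is demanded instead of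
    [subspace] because the union of the empty chain is empty. *)
Lemma exists_complement A B : subspace A -> subspace B -> A `<=` B ->
  exists C, [/\ subspace C, C `<=` B, forall x, A x -> C x -> x = 0
    & forall x, B x -> exists y z, [/\ A y, C z & x = y + z]].
Proof.
move=> sA sB AB.
pose Q C := [/\ forall a x y, C x -> C y -> C (a *: x + y), C `<=` B
  & forall x, A x -> C x -> x = 0].
have [|C [[lC CB AC] maxC]] := @Zorn_bigcup P Q.
  move=> G GQ totG; split=> [a x y [X GX Xx] [Y GY Yy]|x [X /GQ[_ XB _]]|].
  - have [XY|YX] := totG _ _ GX GY.
      by exists Y => //; case: (GQ _ GY) => lY _ _; apply: lY => //; apply: XY.
    by exists X => //; case: (GQ _ GX) => lX _ _; apply: lX => //; apply: YX.
  - exact: XB.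
  - by move=> x Ax [X /GQ[_ _ AX]]; apply: AX.
have C0 : C 0.
  have [[u Cu]|nC] := pselect (exists u, C u).
    by rewrite -(subrr u) -scaleN1r addrC; apply: lC.
  case: (maxC [set 0]); first split=> [x Cx|/(_ 0 erefl) C0].
  - by case: nC; exists x.
  - by case: nC; exists 0.
  - split=> [a x y -> ->|_ ->|//] /=; first by rewrite scaler0 addr0.
    exact: subspace0.
have sC : subspace C by apply/subspaceP.
exists C; split=> // x Bx; apply: contrapT => nx.
pose C' := [set z | exists u k, C u /\ z = u + k *: x].
case: (maxC C'); first split.
- by move=> u Cu; exists u, 0; rewrite scale0r addr0.
- move=> C'C; apply: nx; exists 0, x; split; rewrite ?add0r //.
    exact: subspace0.
  by apply: C'C; exists 0, 1; rewrite scale1r add0r.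
split=> [a _ _ [u [k [Cu ->]]] [v [l [Cv ->]]]|_ [u [k [Cu ->]]]|y Ay].
- exists (a *: u + v), (a * k + l); split; first exact: lC.
  by rewrite scalerDr scalerDl scalerA addrACA.
- by apply: subspaceD => //; [apply: CB|apply: subspaceZ].
- case=> u [k [Cu yE]]; have [k0|k0] := eqVneq k 0.
    by apply: AC => //; rewrite yE k0 scale0r addr0.
  case: nx; exists (k^-1 *: y), (- (k^-1 *: u)); split.
  + exact: subspaceZ.
  + by apply: subspaceN => //; apply: subspaceZ.
  + by rewrite yE scalerDr scalerA mulVf // scale1r addrAC subrr add0r.
Qed.

Lemma direct_sum4_intro A B C D :
  subspace A -> subspace B -> subspace C -> subspace D ->
  (forall x, exists a b c d : P, [/\ A a, B b, C c, D d & x = a + b + c + d]) ->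
  (forall a b c d : P, A a -> B b -> C c -> D d -> a + b + c + d = 0 ->
     [/\ a = 0, b = 0, c = 0 & d = 0]) ->
  direct_sum4 A B C D.
Proof.
move=> sA sB sC sD span indep x; have [a [b [c [d [Aa Bb Cc Dd xE]]]]] := span x.
exists (a, b, c, d); split=> // -[[[a' b'] c'] d'] [Aa' Bb' Cc' Dd' xE'].
have [|||||/subr0_eq-> /subr0_eq-> /subr0_eq-> /subr0_eq->//] :=
  indep (a - a') (b - b') (c - c') (d - d'); try exact: subspaceB.
rewrite (addrACA a) -opprD (addrACA (a + b)) -opprD (addrACA (a + b + c)) -opprD.
by rewrite -xE -xE' subrr.
Qed.

Lemma direct_sum2_4 A B : direct_sum2 A B -> direct_sum4 A B [set 0] (line 0).
Proof.
rewrite line0 => AB x; have [[a b] [[Aa Bb xE] u]] := AB x.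
exists (a, b, 0, 0); split; first by rewrite !addr0.
move=> [[[a' b'] _] _] [Aa' Bb' -> ->]; rewrite !addr0 => xE'.
by have [-> ->] : (a, b) = (a', b') by apply: u.
Qed.

(** The coordinate along [e] is the zero functional when [e = 0], which is the
    case [E = 0]; the factor [(e != 0)%:R] records this. *)
Lemma exists_coordinates E Z V (e c : P) :
  zero_or_line E e -> subspace Z -> subspace V -> direct_sum4 E Z V (line c) ->
  exists (eps : P -> F) (pr : P -> P),
    [/\ forall a x y, eps (a *: x + y) = a * eps x + eps y,
        forall a x y, pr (a *: x + y) = a *: pr x + pr y,
        forall x, V (pr x),
        forall x, exists z k, Z z /\ x = eps x *: e + z + pr x + k *: c
      & forall a z v k, Z z -> V v ->
          eps (a *: e + z + v + k *: c) = (e != 0)%:R * a /\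
          pr (a *: e + z + v + k *: c) = v].
Proof.
move=> zE sZ sV ds; have EE := zero_or_lineE zE.
have uniq4 a z v k a' z' v' k' : Z z -> V v -> Z z' -> V v' ->
    a *: e + z + v + k *: c = a' *: e + z' + v' + k' *: c ->
    a *: e = a' *: e /\ v = v'.
  move=> Zz Vv Zz' Vv' eq4.
  have [[[[w1 w2] w3] w4] [_ u]] := ds (a *: e + z + v + k *: c).
  have wE : (w1, w2, w3, w4) = (a *: e, z, v, k *: c).
    by apply: u; rewrite EE; split=> //; [exists a|exists k].
  have wE' : (w1, w2, w3, w4) = (a' *: e, z', v', k' *: c).
    by apply: u; rewrite EE; split=> //; [exists a'|exists k'].
  by move: wE'; rewrite wE => -[].
have coord x : exists p : F * P, exists z k,
    [/\ Z z, V p.2, e = 0 -> p.1 = 0 & x = p.1 *: e + z + p.2 + k *: c].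
  have [[[[w z] v] u] [[]]] := ds x.
  rewrite EE => -[a _ <-] Zz Vv [k _ <-] -> _.
  exists ((e != 0)%:R * a, v), z, k; split=> // [/= ->|/=].
    by rewrite eqxx mul0r.
  by case: eqP => [->|_]; rewrite ?scaler0 // mul1r.
have [p pP] := choice coord.
have pV x : V (p x).2 by case: (pP x) => z [k []].
have p0 x : e = 0 -> (p x).1 = 0 by case: (pP x) => z [k []].
have pU a z v k : Z z -> V v ->
    (p (a *: e + z + v + k *: c)).1 = (e != 0)%:R * a /\
    (p (a *: e + z + v + k *: c)).2 = v.
  move=> Zz Vv; set x := (X in p X).
  have [z' [k' [Zz' Vv' _ xE]]] := pP x.
  have [e1 ->] := uniq4 _ _ _ _ _ _ _ _ Zz Vv Zz' Vv' xE; split=> //.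
  have [e0|e0] := eqVneq e 0; first by rewrite p0 // mul0r.
  by rewrite mul1r; apply: (scaler_coef_inj e0).
exists (fun x => (p x).1), (fun x => (p x).2).
suff lin a x y : (p (a *: x + y)).1 = a * (p x).1 + (p y).1 /\
                 (p (a *: x + y)).2 = a *: (p x).2 + (p y).2.
  split=> // [a x y|a x y|x]; [by have [] := lin a x y|by have [] := lin a x y|].
  by have [z [k [Zz _ _ xE]]] := pP x; exists z, k.
have [z [k [Zz Vx x0 xE]]] := pP x; have [z' [k' [Zz' Vy y0 yE]]] := pP y.
have -> : a *: x + y = (a * (p x).1 + (p y).1) *: e + (a *: z + z') +
    (a *: (p x).2 + (p y).2) + (a * k + k') *: c.
  rewrite {1}xE {1}yE !scalerDr !scalerDl !scalerA.
  rewrite [LHS]addrACA; congr (_ + _); rewrite [LHS]addrACA; congr (_ + _).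
  by rewrite [LHS]addrACA.
have [||-> ->] := pU (a * (p x).1 + (p y).1) (a *: z + z')
  (a *: (p x).2 + (p y).2) (a * k + k').
- by apply: subspaceD => //; apply: subspaceZ.
- by apply: subspaceD => //; apply: subspaceZ.
split=> //; have [e0|_] := eqVneq e 0; last by rewrite mul1r.
by rewrite mul0r x0 // y0 // mulr0 addr0.
Qed.

Lemma exists_bilinear (f : P -> P -> P) :
  (forall a x y z, f (a *: x + y) z = a *: f x z + f y z) ->
  (forall a x y z, f z (a *: x + y) = a *: f z x + f z y) ->
  exists g : {bilinear P -> P -> P}, forall x y, g x y = f x y.
Proof.
move=> fl fr.
have fP : bilinear_for *:%R *:%R f.
  by split=> [z a x y|z a x y]; [apply: fl|apply: fr].
pose M := bilinear_isBilinear.Build F P P P *:%R *:%R f fP.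
by exists (HB.pack f M : {bilinear P -> P -> P}).
Qed.

Lemma bilinear_on_coef (op : {bilinear P -> P -> P}) V (f : P -> P -> F) c :
  subspace V -> c != 0 -> (forall u v, V u -> V v -> op u v = f u v *: c) ->
  bilinear_on V f.
Proof.
move=> sV c0 fE a u v w Vu Vv Vw.
have Vauv : V (a *: u + v) by case/subspaceP: sV => _; apply.
split; apply: (scaler_coef_inj c0); rewrite scalerDl -scalerA -!fE //.
  exact: linearPl.
exact: linearPr.
Qed.

Lemma bilinear_on0 V f v : subspace V -> bilinear_on V f -> V v ->
  f 0 v = 0 /\ f v 0 = 0.
Proof.
move=> /subspace0 V0 f_lin Vv; have [fl fr] := f_lin (- 1) 0 0 v V0 V0 Vv.
by move: fl fr; rewrite scaler0 addr0 !mulN1r !addNr.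
Qed.

Lemma exists_coefficient (op : P -> P -> P) A c :
  (forall x y, A x -> A y -> exists k, op x y = k *: c) ->
  exists f : P -> P -> F, forall x y, A x -> A y -> op x y = f x y *: c.
Proof.
move=> opc; have [p|f fE] := @choice (P * P) F
  (fun p k => A p.1 -> A p.2 -> op p.1 p.2 = k *: c).
  have [[A1 A2]|nA] := pselect (A p.1 /\ A p.2).
    by have [k kE] := opc _ _ A1 A2; exists k.
  by exists 0 => A1 A2; case: nA.
by exists (fun x y => f (x, y)) => x y; apply: (fE (x, y)).
Qed.

End Subspaces.

(** * The tables define Dedekind Poisson algebras *)

Section Tables.
Variables (F : fieldType) (P : lmodType F) (mul br : {bilinear P -> P -> P}).
Local Notation "x ** y" := (mul x y) (at level 40, left associativity).
Implicit Types (a b k : F) (x y z : P).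

Lemma alternating_anticomm : alternating br -> forall x y, br x y = - br y x.
Proof.
move=> alt x y; apply/eqP; rewrite -addr_eq0; apply/eqP.
by have := alt (x + y); rewrite linearDl !linearDr !alt add0r addr0.
Qed.

(** Common to both types: in type (I) both forms are zero, in type (II) they are
    the forms on [V] composed with the projection to [V]. For [x] in a subalgebra,
    [x^3] yields [e] unless [eps x = 0], and then [x^2] yields [c] unless
    [beta x x = 0]. *)
Lemma normal_form_dedekind (eps : P -> F) (beta omega : P -> P -> F) (e c : P) :
  commutative mul -> alternating br ->
  (forall x y, x ** y = (eps x * eps y) *: e + beta x y *: c) ->
  (forall x y, br x y = omega x y *: c) ->
  (forall x, e ** x = eps x *: e) -> (forall x, c ** x = 0) ->
  (forall x, br e x = 0) -> (forall x, br c x = 0) ->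
  (forall x, beta x x != 0 \/ forall y, beta x y = 0 /\ omega x y = 0) ->
  poisson mul br /\ dedekind mul br.
Proof.
move=> mulC alt mulE brE mule mulc bre brc aniso.
have brN := alternating_anticomm alt.
have mul3 x y z : x ** y ** z = (eps x * eps y * eps z) *: e.
  by rewrite (mulE x y) linearDl !linearZl_LR mule mulc scaler0 addr0 scalerA.
have br_br x y z : br x (br y z) = 0.
  by rewrite brN (brE y) linearZl_LR brc scaler0 oppr0.
have mul_br x y z : x ** br y z = 0.
  by rewrite mulC (brE y) linearZl_LR mulc scaler0.
split.
  split=> // [x y z|x y z|x y z].
  - by rewrite mulC !mul3; congr (_ *: _); ring.
  - by rewrite !br_br !addr0.
  - rewrite mulE linearDl !linearZl_LR bre brc !scaler0 addr0.
    by rewrite !mul_br addr0.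
move=> H [sH mulH brH].
(* The cube kills the component along [c], leaving [eps x ^ 3] times [e]. *)
have He x : H x -> H (eps x *: e).
  move=> Hx; have [->|ex0] := eqVneq (eps x) 0.
    by rewrite scale0r; apply: subspace0.
  have -> : eps x *: e = (eps x ^- 2) *: (x ** x ** x).
    by rewrite mul3 scalerA; congr (_ *: _); field.
  by apply: subspaceZ => //; apply: (mulH) => //; apply: mulH.
have Hc x : H x -> beta x x != 0 -> H c.
  move=> Hx bx0; have -> : c = (beta x x)^-1 *: (x ** x - eps x *: (eps x *: e)).
    by rewrite mulE scalerA addrC addKr scalerA mulVf // scale1r.
  apply: subspaceZ => //; apply: subspaceB => //; first exact: mulH.
  by apply: subspaceZ => //; apply: He.
split=> // y x Hx.
  rewrite mulC mulE mulrC -scalerA; apply: subspaceD => //.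
    by apply: subspaceZ => //; apply: He.
  have [bx0|/(_ y)[-> _]] := aniso x; last by rewrite scale0r; apply: subspace0.
  by apply: subspaceZ => //; apply: (Hc x).
rewrite brN brE; apply: subspaceN => //.
have [bx0|/(_ y)[_ ->]] := aniso x; last by rewrite scale0r; apply: subspace0.
by apply: subspaceZ => //; apply: (Hc x).
Qed.

Lemma table_I_dedekind (E Z : set P) (e : P) :
  commutative mul -> alternating br -> decomposition_I E Z e ->
  table_I mul br Z e -> poisson mul br /\ dedekind mul br.
Proof.
move=> mulC alt [zE sZ ds] [ee mulZ br0].
have ds4 := direct_sum2_4 ds.
have [eps [pr [_ _ pr0 coord uniq]]] :=
  exists_coordinates zE sZ (@subspace_set0 F P) ds4.
have mulxy x y : x ** y = eps x *: (e ** y).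
  have [z [k [Zz {1}->]]] := coord x.
  by rewrite pr0 scaler0 !addr0 linearDl linearZl_LR (mulZ z) // addr0.
have mule x : e ** x = eps x *: e by rewrite mulC mulxy ee.
have bra x y : br x y = 0 by exact: br0.
apply: (@normal_form_dedekind eps (fun _ _ => 0) (fun _ _ => 0) e 0) => //.
- by move=> x y; rewrite mulxy mule scalerA scaler0 addr0.
- by move=> x y; rewrite bra scaler0.
- by move=> x; rewrite linear0l.
- by right.
Qed.

Lemma table_II_dedekind (E Z V : set P) (e c : P) (beta omega : P -> P -> F) :
  commutative mul -> alternating br -> decomposition_II E Z V e c ->
  forms_II V beta omega -> table_II mul br E Z V e c beta omega ->
  poisson mul br /\ dedekind mul br.
Proof.
move=> mulC alt [zE sZ [sV _] c0 ds] [[beta_lin _] [omega_lin _] aniso].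
case=> ee mulV brV [mulZ mulc mulEV] [brZ brc brE].
have brN := alternating_anticomm alt.
have EE := zero_or_lineE zE.
have Ee : E e by rewrite EE; apply: line_id.
have mulc0 x : c ** x = 0 by apply: mulc => //; apply: line_id.
have brc0 x : br c x = 0 by apply: brc => //; apply: line_id.
have bre0 x : br e x = 0 by apply: brE.
have [eps [pr [_ _ prV coord _]]] := exists_coordinates zE sZ sV ds.
have mulx x y : x ** y = eps x *: (e ** y) + pr x ** y.
  have [z [k [Zz {1}->]]] := coord x.
  by rewrite !linearDl !linearZl_LR (mulZ z) // mulc0 scaler0 !addr0.
have brx x y : br x y = br (pr x) y.
  have [z [k [Zz {1}->]]] := coord x.
  by rewrite !linearDl !linearZl_LR (brZ z) // brc0 bre0 !scaler0 !addr0 add0r.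
have mule x : e ** x = eps x *: e.
  by rewrite mulC mulx ee (mulC _ e) (mulEV e) // addr0.
apply: (@normal_form_dedekind eps (fun x y => beta (pr x) (pr y))
  (fun x y => omega (pr x) (pr y)) e c) => //.
- move=> x y; rewrite mulx mule scalerA; congr (_ + _).
  by rewrite mulC mulx (mulEV e) // scaler0 add0r mulC mulV.
- by move=> x y; rewrite brx brN brx -brN brV.
- move=> x; have [p0|p0] := eqVneq (pr x) 0; last by left; apply: aniso.
  right=> y; rewrite p0; have [-> _] := bilinear_on0 sV beta_lin (prV y).
  by have [-> _] := bilinear_on0 sV omega_lin (prV y).
Qed.

End Tables.

(** * Every table is realised *)

Section Realisation.
Variables (F : fieldType) (P : lmodType F).

Lemma table_I_realised (E Z : set P) (e : P) : decomposition_I E Z e ->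
  exists mul br : {bilinear P -> P -> P},
    [/\ poisson mul br, dedekind mul br & table_I mul br Z e].
Proof.
move=> dI; have [zE sZ ds] := dI.
have ds4 := direct_sum2_4 ds.
have [eps [pr [eps_lin _ _ _ uniq]]] :=
  exists_coordinates zE sZ (@subspace_set0 F P) ds4.
have epsE a z : Z z -> eps (a *: e + z) = (e != 0)%:R * a.
  by move=> Zz; have [] := uniq a z 0 0 Zz erefl; rewrite scaler0 !addr0.
have [mul mulE] : exists g : {bilinear P -> P -> P},
    forall x y, g x y = (eps x * eps y) *: e.
  apply: exists_bilinear => a x y z.
    by rewrite eps_lin scalerA -scalerDl mulrDl mulrA.
  by rewrite eps_lin scalerA -scalerDl mulrDr; congr ((_ + _) *: _); ring.
have [br brE] : exists g : {bilinear P -> P -> P}, forall x y, g x y = 0.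
  by apply: exists_bilinear => a x y z; rewrite scaler0 addr0.
have tI : table_I mul br Z e.
  split=> [|z y Zz _|x y _ _]; rewrite ?mulE ?brE //.
    have := epsE 1 0 (subspace0 sZ); rewrite scale1r addr0 mulr1 => ->.
    by case: eqP => [->|_]; rewrite ?scaler0 // mulr1 scale1r.
  by have := epsE 0 z Zz; rewrite scale0r add0r mulr0 => ->; rewrite mul0r scale0r.
exists mul, br; have [||//] := table_I_dedekind _ _ dI tI.
- by move=> x y; rewrite !mulE mulrC.
- by move=> x; rewrite brE.
Qed.

Lemma table_II_realised (E Z V : set P) (e c : P) (beta omega : P -> P -> F) :
  decomposition_II E Z V e c -> forms_II V beta omega ->
  exists mul br : {bilinear P -> P -> P},
    [/\ poisson mul br, dedekind mul br
      & table_II mul br E Z V e c beta omega].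
Proof.
move=> dII fII; have [zE sZ [sV _] c0 ds] := dII.
have [[beta_lin beta_sym] [omega_lin omega_alt] _] := fII.
have [eps [pr [eps_lin pr_lin prV _ uniq]]] := exists_coordinates zE sZ sV ds.
have Z0 := subspace0 sZ; have V0 := subspace0 sV.
have EE := zero_or_lineE zE.
have coordE a : eps (a *: e) = (e != 0)%:R * a /\ pr (a *: e) = 0.
  by have := uniq a 0 0 0 Z0 V0; rewrite scale0r !addr0.
have coordZ z : Z z -> eps z = 0 /\ pr z = 0.
  by move=> Zz; have := uniq 0 z 0 0 Zz V0; rewrite !scale0r !addr0 add0r mulr0.
have coordV v : V v -> eps v = 0 /\ pr v = v.
  by move=> Vv; have := uniq 0 0 v 0 Z0 Vv; rewrite !scale0r addr0 !add0r mulr0.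
have coordc k : eps (k *: c) = 0 /\ pr (k *: c) = 0.
  by have := uniq 0 0 0 k Z0 V0; rewrite scale0r !add0r mulr0.
have [mul mulE] : exists g : {bilinear P -> P -> P}, forall x y,
    g x y = (eps x * eps y) *: e + beta (pr x) (pr y) *: c.
  apply: exists_bilinear => a x y z; rewrite eps_lin pr_lin.
    have [-> _] := beta_lin a _ _ _ (prV x) (prV y) (prV z).
    by rewrite mulrDl !scalerDl scalerDr !scalerA -mulrA [LHS]addrACA.
  have [_ ->] := beta_lin a _ _ _ (prV x) (prV y) (prV z).
  by rewrite mulrDr !scalerDl scalerDr !scalerA mulrCA [LHS]addrACA.
have [br brE] : exists g : {bilinear P -> P -> P}, forall x y,
    g x y = omega (pr x) (pr y) *: c.
  apply: exists_bilinear => a x y z; rewrite pr_lin.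
    have [-> _] := omega_lin a _ _ _ (prV x) (prV y) (prV z).
    by rewrite scalerDl scalerA.
  have [_ ->] := omega_lin a _ _ _ (prV x) (prV y) (prV z).
  by rewrite scalerDl scalerA.
have mul0 x y : eps x = 0 -> pr x = 0 -> mul x y = 0.
  move=> ex px; rewrite mulE ex px mul0r scale0r add0r.
  by have [-> _] := bilinear_on0 sV beta_lin (prV y); rewrite scale0r.
have br0 x y : pr x = 0 -> br x y = 0.
  move=> px; rewrite brE px.
  by have [-> _] := bilinear_on0 sV omega_lin (prV y); rewrite scale0r.
have tII : table_II mul br E Z V e c beta omega.
  split.
  - have [] := coordE 1; rewrite scale1r mulr1 mulE => -> ->.
    have [-> _] := bilinear_on0 sV beta_lin V0; rewrite scale0r addr0.
    by case: eqP => [->|_]; rewrite ?scaler0 // mulr1 scale1r.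
  - move=> u v Vu Vv; rewrite mulE.
    have [-> ->] := coordV u Vu; have [-> ->] := coordV v Vv.
    by rewrite mul0r scale0r add0r.
  - move=> u v Vu Vv; rewrite brE.
    by have [_ ->] := coordV u Vu; have [_ ->] := coordV v Vv.
  - split=> [z y Zz _|_ y [k _ <-] _|].
    + by have [] := coordZ z Zz; apply: mul0.
    + by have [] := coordc k; apply: mul0.
    + rewrite EE => _ v [a _ <-] Vv; rewrite mulE.
      have [_ ->] := coordE a; have [-> ->] := coordV v Vv.
      by have [-> _] := bilinear_on0 sV beta_lin Vv; rewrite mulr0 !scale0r addr0.
  - split=> [z y Zz _|_ y [k _ <-] _|].
    + by have [_] := coordZ z Zz; apply: br0.
    + by have [_] := coordc k; apply: br0.
    + by rewrite EE => _ y [a _ <-] _; have [_] := coordE a; apply: br0.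
exists mul, br; have [||//] := table_II_dedekind _ _ dII fII tII.
- by move=> x y; rewrite !mulE mulrC beta_sym.
- by move=> x; rewrite brE omega_alt // scale0r.
Qed.

End Realisation.

(** * Dedekind Poisson algebras: abelian subalgebras and idempotents *)

Section Classification.
Variables (F : fieldType) (P : lmodType F) (mul br : {bilinear P -> P -> P}).
Local Notation "x ** y" := (mul x y) (at level 40, left associativity).
Implicit Types (a b k : F) (x y z u : P) (C : set P).

Hypothesis poissonP : poisson mul br.

Local Lemma mulC : commutative mul.
Proof. by case: poissonP. Qed.

Local Lemma mulA : associative mul.
Proof. by case: poissonP. Qed.

Local Lemma brxx : alternating br.
Proof. by case: poissonP. Qed.

Local Lemma brM : leibniz mul br.
Proof. by case: poissonP. Qed.

Local Lemma brN x y : br x y = - br y x.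
Proof. exact: (alternating_anticomm brxx). Qed.

Local Lemma mulAC x y z : x ** y ** z = x ** z ** y.
Proof. by rewrite -!mulA (mulC y). Qed.

Definition abelian_subalgebra C :=
  [/\ subspace C, forall x y, C x -> C y -> C (x ** y)
    & forall x y, C x -> C y -> br x y = 0].

(** The bracket bicommutant replaces the algebra of polynomials in [u]
    without constant term: it contains [u], and its elements commute with each
    other for the bracket because each of them commutes with everything that
    commutes with [u]. *)
Lemma exists_abelian_subalgebra u : exists2 C, abelian_subalgebra C & C u.
Proof.
pose C := [set w | forall t, br u t = 0 -> br t w = 0].
exists C => [|t /=]; last by rewrite brN => /eqP; rewrite oppr_eq0 => /eqP.
split=> [|x y Cx Cy t ut|x y Cx Cy].
- apply/subspaceP; split=> [t _|a x y Cx Cy t ut]; first by rewrite linear0r.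
  by rewrite linearPr Cx // Cy // scaler0 addr0.
- rewrite brN brM (brN y) (brN x) Cx // Cy // oppr0 !linear0r addr0 oppr0 //.
- by apply: Cy; apply: Cx; apply: brxx.
Qed.

(** The ideal [F u + u C] of [C] generated by [u], for [C] without identity. *)
Definition principal C u := [set t | exists a w, C w /\ t = a *: u + u ** w].

Lemma principal_abelian C u : abelian_subalgebra C -> C u ->
  abelian_subalgebra (principal C u) /\ principal C u u.
Proof.
move=> [sC mulCC brC] Cu; have sub t : principal C u t -> C t.
  move=> [a [w [Cw ->]]]; apply: subspaceD => //; last exact: mulCC.
  exact: subspaceZ.
split; last first.
  exists 1, 0; rewrite linear0r addr0 scale1r; split=> //; exact: subspace0.
split=> [|x y [a [w [Cw ->]]] /sub Cy|x y /sub Cx /sub Cy]; last exact: brC.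
  apply/subspaceP; split.
    exists 0, 0; rewrite linear0r addr0 scale0r; split=> //; exact: subspace0.
  move=> k _ _ [a [w [Cw ->]]] [b [v [Cv ->]]].
  exists (k * a + b), (k *: w + v); split.
    by apply: subspaceD => //; apply: subspaceZ.
  by rewrite linearPr scalerDr scalerDl scalerA addrACA.
exists 0, (a *: y + w ** y); split.
  apply: subspaceD => //; last exact: mulCC.
  exact: subspaceZ.
by rewrite scale0r add0r linearDl linearDr linearZl_LR linearZr_LR mulA.
Qed.

Hypothesis dedekindP : dedekind mul br.

Lemma abelian_ideal C x y : abelian_subalgebra C -> C x ->
  C (y ** x) /\ C (br y x).
Proof.
move=> [sC mulCC brC] Cx.
have [//|_ mulH brH] := @dedekindP C; last by split; [apply: mulH|apply: brH].
by split=> // z t Cz Ct; rewrite brC //; apply: subspace0.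
Qed.

Lemma line_ideal x k : x ** x = k *: x -> forall y,
  (exists a, y ** x = a *: x) /\ (exists a, br y x = a *: x).
Proof.
move=> xx y; have [||[a _ ax] [b _ bx]] := @abelian_ideal (line x) x y.
- split=> [|_ _ [a _ <-] [b _ <-]|_ _ [a _ <-] [b _ <-]].
  + exact: subspace_line.
  + exists (a * (b * k)); first by [].
    by rewrite linearZl_LR linearZr_LR xx !scalerA mulrA.
  + by rewrite linearZl_LR linearZr_LR brxx !scaler0.
- exact: line_id.
by split; [exists a|exists b].
Qed.

Lemma idempotent_line e : e ** e = e -> forall y,
  (exists a, y ** e = a *: e) /\ (exists a, br y e = a *: e).
Proof. by move=> ee; apply: (@line_ideal e 1); rewrite scale1r. Qed.

(** If [[e, y] = k e], then Leibniz for [e = e e] gives [k e = 2 k e]. *)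
Lemma idempotent_central e : e ** e = e -> forall y, br e y = 0.
Proof.
move=> ee y; have [_ [k kE]] := idempotent_line ee y.
have be : br e y = (- k) *: e by rewrite brN kE scaleNr.
have := brM e e y; rewrite ee be linearZr_LR ee => /eqP.
by rewrite -[X in X == _]addr0 (inj_eq (addrI _)) eq_sym => /eqP.
Qed.

(** Two distinct nonzero idempotents would, after the ideal property of their
    lines has forced their product to vanish, give an idempotent [e + f] whose
    line is not an ideal. *)
Lemma idempotent_unique e f : e ** e = e -> f ** f = f -> e != 0 -> f != 0 ->
  e = f.
Proof.
move=> ee ff e0 f0.
have lin g : g ** g = g -> forall y, exists a, y ** g = a *: g.
  by move=> gg y; have [] := idempotent_line gg y.
have [k kE] := lin e ee f; have [l lE] := lin f ff e.
have efl : e ** (e ** f) = e ** f by rewrite mulA ee.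
have eff : f ** (f ** e) = f ** e by rewrite mulA ff.
have [ef0|ef0] := eqVneq (e ** f) 0; last first.
  have fe0 : f ** e != 0 by rewrite mulC.
  move: efl; rewrite {1}lE linearZr_LR => efl.
  move: eff; rewrite {1}kE linearZr_LR => eff.
  have l1 : l = 1 by apply: (scaler_coef_inj ef0); rewrite efl scale1r.
  have k1 : k = 1 by apply: (scaler_coef_inj fe0); rewrite eff scale1r.
  by move: kE; rewrite mulC lE l1 k1 !scale1r.
have ef2 : (e + f) ** (e + f) = e + f.
  by rewrite linearDl !linearDr ee ff (mulC f) ef0 addr0 add0r.
have [m mE] := lin _ ef2 e; move: mE; rewrite linearDr ee ef0 addr0 => mE.
have /eqP : f ** e = m *: f by rewrite mE linearZr_LR linearDr ff mulC ef0 add0r.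
rewrite mulC ef0 eq_sym scaler_eq0 (negPf f0) orbF => /eqP m0.
by move: e0; rewrite mE m0 scale0r eqxx.
Qed.

(** The witness is [0] when there is no nonzero idempotent, so that both cases of
    the summand [E] are treated at once. *)
Lemma exists_idempotent : exists2 e, e ** e = e &
  forall f, f ** f = f -> f = 0 \/ f = e.
Proof.
have [[e ee e0]|ne] := pselect (exists2 e, e ** e = e & e != 0).
  exists e => // f ff; have [|f0] := eqVneq f 0; [by left|right].
  exact: idempotent_unique.
exists 0 => [|f ff]; first by rewrite linear0l.
by left; apply: contrapT => /eqP f0; apply: ne; exists f.
Qed.

(** * Dedekind Poisson algebras: the annihilator of the idempotent *)

Variable e : P.
Hypotheses (ee : e ** e = e) (e_unique : forall f, f ** f = f -> f = 0 \/ f = e).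

Let N : set P := [set x | e ** x = 0].

Local Lemma subspace_N : subspace N.
Proof.
apply/subspaceP; split=> [|a x y Nx Ny]; first exact: linear0r.
by rewrite /N /= linearPr Nx Ny scaler0 addr0.
Qed.

Local Lemma N_mulr x y : N x -> N (x ** y).
Proof. by move=> Nx; rewrite /N /= mulA Nx linear0l. Qed.

Local Lemma N_idempotent f : N f -> f ** f = f -> f = 0.
Proof. by move=> Nf ff; case: (e_unique ff) => // fe; move: Nf; rewrite fe /N /= ee. Qed.

(** The relation [y^3 = y^3 s] with [s = b y + y w] iterates to
    [s^3 = s^3 s], because [s^3] is obtained from [y^3] by applying three times
    the operator [t |-> b t + t w], which commutes with multiplication by [s].
    Hence [s^3] is an idempotent of [N], so it vanishes, and
    [y^3 = y^3 s^3 = 0]. *)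
Lemma cube_eq0_of_absorb b w y : N y ->
  y ** y ** y = y ** y ** y ** (b *: y + y ** w) -> y ** y ** y = 0.
Proof.
move=> Ny; set s := _ + _; set q := y ** y ** y => qs.
pose m t := b *: t + t ** w.
have mM t z : m t ** z = m (t ** z).
  by rewrite /m linearDl linearZl_LR mulAC.
have Mm t z : z ** m t = m (z ** t) by rewrite mulC mM mulC.
have s3E : s ** s ** s = m (m (m q)).
  by have -> : s = m y by []; rewrite !(mM, Mm).
have s3s : s ** s ** s ** s = s ** s ** s by rewrite s3E !mM -qs.
have s30 : s ** s ** s = 0.
  apply: N_idempotent; last by rewrite !mulA !s3s.
  do 2!apply: N_mulr; apply: subspaceD; first exact: subspace_N.
    by apply: subspaceZ => //; apply: subspace_N.
  exact: N_mulr.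
by rewrite qs qs qs -!mulA (mulA s) s30 !linear0r.
Qed.

(** The elements [a y^2 + b y^4 + y^4 w], with [w] in an algebra that is abelian
    for the bracket, form a subalgebra; being an ideal, it contains [y^3], and
    either [a = 0] or solving for [y^2] makes [y^3] a multiple of itself. *)
Lemma cube_eq0 y : N y -> y ** y ** y = 0.
Proof.
move=> Ny; have [C abC Cy] := exists_abelian_subalgebra y.
have Cy2 : C (y ** y) by case: abC => _ mulCC _; apply: mulCC.
have [abD Dy2] := principal_abelian abC Cy2.
have [abH Hy2] := principal_abelian abD Dy2.
have [[a [_ [[b [w [_ ->]]] yE]]] _] := abelian_ideal y abH Hy2.
set q := y ** y ** y.
have {}yE : q = a *: (y ** y) + q ** (b *: y + y ** w).
  rewrite {1}/q -mulA yE; congr (_ + _).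
  have <- : y ** (b *: y + y ** w) = b *: (y ** y) + y ** y ** w.
    by rewrite linearDr linearZr_LR mulA.
  exact: mulA.
have [a0|a0] := eqVneq a 0.
  by apply: (@cube_eq0_of_absorb b w) => //; rewrite -/q {1}yE a0 scale0r add0r.
have qy : q ** y = a *: q + q ** (y ** (b *: y + y ** w)).
  by rewrite {1}yE linearDl linearZl_LR -(mulA q) (mulC (_ + _) y).
apply: (@cube_eq0_of_absorb a^-1 (- a^-1 *: (b *: y + y ** w))) => //.
rewrite -/q linearDr !linearZr_LR /= qy scalerDr scalerA mulVf // scale1r.
by rewrite scaleNr addrK.
Qed.

Local Lemma br_sq x y : br y (x ** x) = x ** br y x + x ** br y x.
Proof. by rewrite brN brM (brN x) !linearN -opprD opprK. Qed.

Local Lemma mul_sq_self x : N x -> x ** (x ** x) = 0.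
Proof. by move=> Nx; rewrite mulA cube_eq0. Qed.

(** Elements of [F x + F x^2] already form a subalgebra since [x^3 = 0]. *)
Lemma span_sq_ideal x y : N x ->
  (exists a b, y ** x = a *: x + b *: (x ** x)) /\
  (exists a b, br y x = a *: x + b *: (x ** x)).
Proof.
move=> Nx; pose C := [set t | exists a b, t = a *: x + b *: (x ** x)].
have x3 := mul_sq_self Nx.
have x4 : x ** x ** (x ** x) = 0 by rewrite -mulA x3 linear0r.
have bx2 : br x (x ** x) = 0 by rewrite br_sq brxx linear0r addr0.
apply: (@abelian_ideal C); last first.
  by exists 1, 0; rewrite scale1r scale0r addr0.
split.
- apply/subspaceP; split; first by exists 0, 0; rewrite !scale0r addr0.
  move=> k _ _ [a [b ->]] [a' [b' ->]]; exists (k * a + a'), (k * b + b').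
  by rewrite scalerDr !scalerDl !scalerA addrACA.
- move=> _ _ [a [b ->]] [a' [b' ->]]; exists 0, (a * a').
  rewrite linearDl !linearDr !linearZl_LR !linearZr_LR x3 x4 (mulC _ x) x3.
  by rewrite !scaler0 !addr0 scale0r add0r scalerA.
- move=> _ _ [a [b ->]] [a' [b' ->]].
  rewrite linearDl !linearDr !linearZl_LR !linearZr_LR !brxx bx2 (brN _ x) bx2.
  by rewrite oppr0 !scaler0 !addr0.
Qed.

(** The line of [x^2] is an ideal as [x^4 = 0], and [y] acts on it by a scalar [k]
    with [k^3 = 0]. *)
Lemma mul_sq_eq0 x y : N x -> N y -> y ** (x ** x) = 0.
Proof.
move=> Nx Ny.
have x4 : x ** x ** (x ** x) = 0 *: (x ** x).
  by rewrite -mulA mul_sq_self // linear0r scale0r.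
have [[k kE] _] := line_ideal x4 y; rewrite kE.
have [->|k0] := eqVneq k 0; first by rewrite scale0r.
have /eqP : y ** (y ** (y ** (x ** x))) = 0 by rewrite !mulA cube_eq0 // !linear0l.
rewrite !(kE, linearZr_LR) !scaler_eq0 (negPf k0) /= => /eqP ->.
by rewrite scaler0.
Qed.

(** If [y x = a x + b x^2], then [y^2 x = a (y x)] because [y x^2 = 0]; now
    [0 = y^3 x = a^2 (y x)]. *)
Lemma mul_in_sq x y : N x -> N y -> exists k, y ** x = k *: (x ** x).
Proof.
move=> Nx Ny; have [[a [b yxE]] _] := span_sq_ideal y Nx.
have [a0|a0] := eqVneq a 0; first by exists b; rewrite yxE a0 scale0r add0r.
have yyx : y ** (y ** x) = a *: (y ** x).
  by rewrite {1}yxE linearDr !linearZr_LR mul_sq_eq0 // scaler0 addr0.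
have /eqP : y ** (y ** (y ** x)) = 0 by rewrite !mulA cube_eq0 // linear0l.
rewrite yyx linearZr_LR yyx !scaler_eq0 (negPf a0) /= => /eqP ->.
by exists 0; rewrite scale0r.
Qed.

(** Writing [[y, x] = a x + b x^2] and, by symmetry, as a combination of [y] and
    [y^2], one gets [[y, [y, x]] = 0], i.e. [a [y, x] + b [y, x^2] = 0] with
    [[y, x^2] = 2 a x^2]; for [a <> 0] this puts [[y, x]] in [F x^2]. *)
Lemma br_in_sq x y : N x -> N y -> exists k, br y x = k *: (x ** x).
Proof.
move=> Nx Ny; have [_ [a [b yxE]]] := span_sq_ideal y Nx.
have [_ [a' [b' xyE]]] := span_sq_ideal x Ny.
have [a0|a0] := eqVneq a 0; first by exists b; rewrite yxE a0 scale0r add0r.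
have yyx : br y (br y x) = 0.
  rewrite (brN y x) xyE linearNr linearDr !linearZr_LR br_sq brxx linear0r.
  by rewrite !addr0 !scaler0 addr0 oppr0.
have yx2 : br y (x ** x) = (a + a) *: (x ** x).
  rewrite br_sq yxE linearDr !linearZr_LR mul_sq_self // scaler0 addr0.
  by rewrite scalerDl.
exists (- (a^-1 * (b * (a + a)))).
move: yyx; rewrite {1}yxE linearDr !linearZr_LR yx2 scalerA => /eqP.
rewrite addr_eq0 => /eqP /(congr1 ( *:%R a^-1)).
by rewrite scalerA mulVf // scale1r scalerN scalerA scaleNr.
Qed.

(** If [x x0 <> 0], it is a common multiple of both squares. Otherwise
    [(x + x0) x0 = x0^2] is a multiple of [(x + x0)^2 = x^2 + x0^2]. *)
Lemma sq_proportional x0 x : N x0 -> N x -> x0 ** x0 != 0 ->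
  exists k, x ** x = k *: (x0 ** x0).
Proof.
move=> N0 Nx c0; have [l lE] := mul_in_sq Nx N0.
have [k kE] := mul_in_sq N0 Nx.
have [l0|l0] := eqVneq l 0; last first.
  exists (l^-1 * k); rewrite -scalerA -kE mulC lE scalerA mulVf //.
  by rewrite scale1r.
have xx0 : x0 ** x = 0 by rewrite lE l0 scale0r.
have [|m mE] := @mul_in_sq (x + x0) x0 _ N0.
  by apply: subspaceD => //; apply: subspace_N.
move: mE; rewrite linearDl !linearDr xx0 (mulC x) xx0 addr0 !add0r => mE.
have [m0|m0] := eqVneq m 0.
  by move: c0; rewrite mE m0 scale0r eqxx.
exists (m^-1 - 1); rewrite scalerBl scale1r {1}mE scalerA mulVf // scale1r.
by rewrite addrK.
Qed.

Local Lemma N_component x : exists a, N (x - a *: e).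
Proof.
have [[a aE] _] := idempotent_line ee x.
by exists a; rewrite /N /= linearBr linearZr_LR ee mulC aE subrr.
Qed.

Local Lemma e_zero_or_line : zero_or_line (line e) e.
Proof.
have [->|e0] := eqVneq e 0; last by right.
by left; rewrite line0.
Qed.

Local Lemma e_N_uniq a b x y : N x -> N y -> a *: e + x = b *: e + y ->
  a *: e = b *: e /\ x = y.
Proof.
move=> Nx Ny eq_axy; have ab : a *: e = b *: e.
  have := congr1 (mul e) eq_axy.
  by rewrite !linearDr !linearZr_LR ee Nx Ny !addr0.
by split=> //; move: eq_axy; rewrite ab => /addrI.
Qed.

(** Without nonzero squares, [mul_in_sq] and [br_in_sq] kill all operations on
    [N]. *)
Lemma sq_zero_type_I : (forall x, N x -> x ** x = 0) -> type_I mul br.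
Proof.
move=> sq0; exists (line e), N, e.
have mul0 x y : N x -> N y -> x ** y = 0.
  by move=> Nx Ny; have [k ->] := mul_in_sq Ny Nx; rewrite sq0 ?scaler0.
have br0 x y : N x -> N y -> br x y = 0.
  by move=> Nx Ny; have [k ->] := br_in_sq Ny Nx; rewrite sq0 ?scaler0.
have bre y : br e y = 0 by apply: idempotent_central.
split; split=> //.
- exact: e_zero_or_line.
- exact: subspace_N.
- move=> x; have [a Na] := N_component x; exists (a *: e, x - a *: e); split.
    by split; rewrite ?subrKC //; exists a.
  move=> [_ z] [[b _ <-] Nz xE].
  by have [|-> ->] := @e_N_uniq a b (x - a *: e) z Na Nz; rewrite ?subrKC.
- move=> z y Nz _; have [a Na] := N_component y.
  rewrite -(subrKC (a *: e) y) linearDr linearZr_LR (mul0 z (_ - _)) // mulC Nz.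
  by rewrite scaler0 addr0.
- move=> x y _ _; have [a Na] := N_component x; have [b Nb] := N_component y.
  rewrite -(subrKC (a *: e) x) linearDl linearZl_LR bre scaler0 add0r.
  rewrite -(subrKC (b *: e) y) linearDr linearZr_LR brN bre oppr0 scaler0 add0r.
  exact: br0.
Qed.

(** The elements of [N] of square zero form a subspace [Z0] annihilated by all
    operations, and [c = x0^2] lies in it. Then [Z0 = F c + Z] and [N = Z0 + V]
    with [V] free of nonzero elements of square zero. *)
Lemma sq_nonzero_type_II x0 : N x0 -> x0 ** x0 != 0 -> type_II mul br.
Proof.
move=> N0; set c := x0 ** x0 => c0.
have sN := subspace_N.
have bre y : br e y = 0 by apply: idempotent_central.
have Nc : N c by apply: N_mulr.
have mul_c x y : N x -> N y -> exists k, x ** y = k *: c.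
  move=> Nx Ny; have [k ->] := mul_in_sq Ny Nx.
  by have [l ->] := sq_proportional N0 Ny c0; exists (k * l); rewrite scalerA.
have br_c x y : N x -> N y -> exists k, br x y = k *: c.
  move=> Nx Ny; have [k ->] := br_in_sq Ny Nx.
  by have [l ->] := sq_proportional N0 Ny c0; exists (k * l); rewrite scalerA.
(* An element of square zero kills [N] by [mul_in_sq] and [br_in_sq]. *)
pose Z0 : set P := [set x | N x /\ x ** x = 0].
have mulZ0 x y : Z0 x -> x ** y = 0.
  move=> [Nx xx]; have [a Na] := N_component y.
  rewrite -(subrKC (a *: e) y) linearDr linearZr_LR mulC Nx scaler0 add0r mulC.
  by have [k ->] := mul_in_sq Nx Na; rewrite xx scaler0.
have brZ0 x y : Z0 x -> br x y = 0.
  move=> [Nx xx]; have [a Na] := N_component y.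
  rewrite -(subrKC (a *: e) y) linearDr linearZr_LR brN bre oppr0 scaler0 add0r.
  by rewrite brN; have [k ->] := br_in_sq Nx Na; rewrite xx scaler0 oppr0.
have sZ0 : subspace Z0.
  apply/subspaceP; split=> [|a x y Zx Zy].
    by split; [apply: subspace0|rewrite linear0l].
  split; last by rewrite linearDl linearZl_LR !mulZ0 // scaler0 addr0.
  by apply: subspaceD => //; [apply: subspaceZ => //; case: Zx|case: Zy].
have Z0c : Z0 c by split=> //; apply: mul_sq_eq0.
have cZ0 : line c `<=` Z0 by move=> _ [k _ <-]; apply: subspaceZ.
have Z0N : Z0 `<=` N by move=> x [].
have [Z [sZ ZZ0 cZ Z0E]] := exists_complement (subspace_line c) sZ0 cZ0.
have [V [sV VN Z0V NE]] := exists_complement sZ0 sN Z0N.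
have [beta betaE] := exists_coefficient mul_c.
have [omega omegaE] := exists_coefficient br_c.
have betaV u v : V u -> V v -> u ** v = beta u v *: c.
  by move=> /VN Nu /VN Nv; apply: betaE.
have omegaV u v : V u -> V v -> br u v = omega u v *: c.
  by move=> /VN Nu /VN Nv; apply: omegaE.
exists (line e), Z, V, e, c, beta, omega; split.
- split=> //; first exact: e_zero_or_line.
    split=> // V0; have [y [z [Z0y Vz x0E]]] := NE x0 N0.
    have z0 : z = 0 by move: Vz; rewrite V0.
    by case: Z0y => _ yy; move: c0; rewrite /c x0E z0 addr0 yy eqxx.
  apply: direct_sum4_intro => //; try exact: subspace_line.
    move=> x; have [a Na] := N_component x; have [y [v [Z0y Vv xE]]] := NE _ Na.
    have [d [z [cd Zz yE]]] := Z0E y Z0y.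
    exists (a *: e), z, v, d; split=> //; first by exists a.
    rewrite -(subrKC (a *: e) x) xE yE -!addrA; congr (_ + _).
    by rewrite addrCA; congr (_ + _); rewrite addrC.
  move=> _ z v d [a _ <-] Zz Vv cd sum0.
  have Z0z := ZZ0 _ Zz; have Z0d := cZ0 _ cd.
  have [|||-> zvd] := @e_N_uniq a 0 (z + v + d) 0.
  + by apply: subspaceD; [|apply: subspaceD; [|apply: Z0N|apply: VN]|apply: Z0N].
  + exact: subspace0.
  + by rewrite scale0r addr0 !addrA.
  have v0 : v = 0.
    apply: Z0V => //; have -> : v = - (z + d).
      by apply/eqP; rewrite -addr_eq0 addrCA addrA zvd.
    by apply: subspaceN => //; apply: subspaceD.
  move: zvd; rewrite v0 addr0 => /eqP; rewrite addr_eq0 => /eqP zE.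
  have d0 : d = 0.
    by apply: cZ => //; rewrite -[d]opprK -zE; apply: subspaceN.
  by rewrite scale0r zE d0 oppr0.
- split.
  + split; first exact: (bilinear_on_coef sV c0 betaV).
    by move=> u v Vu Vv; apply: (scaler_coef_inj c0); rewrite -!betaV // mulC.
  + split; first exact: (bilinear_on_coef sV c0 omegaV).
    move=> v Vv; apply: (scaler_coef_inj c0); rewrite -omegaV // brxx scale0r //.
  + move=> v Vv; apply: contra => /eqP b0; apply/eqP; apply: Z0V => //.
    by split; [apply: VN|rewrite betaV // b0 scale0r].
- split=> //; split.
  + by move=> z y /ZZ0 Zz _; apply: mulZ0.
  + by move=> z y /cZ0 Zz _; apply: mulZ0.
  + by move=> _ v [a _ <-] /VN Nv; rewrite linearZl_LR Nv scaler0.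
  + by move=> z y /ZZ0 Zz _; apply: brZ0.
  + by move=> z y /cZ0 Zz _; apply: brZ0.
  + by move=> _ v [a _ <-] _; rewrite linearZl_LR bre scaler0.
Qed.

Lemma dedekind_type : type_I mul br \/ type_II mul br.
Proof.
have [[x [Nx x0]]|sq0] := pselect (exists x, N x /\ x ** x != 0).
  by right; apply: (sq_nonzero_type_II Nx).
left; apply: sq_zero_type_I => x Nx; apply: contrapT => /eqP x0.
by apply: sq0; exists x.
Qed.

End Classification.

(** * The classification *)

(* The last three clauses are the converse: commutative and alternating        *)
(* bilinear operations satisfying a table form a Dedekind Poisson algebra, and *)
(* every table is realised on every space decomposed as required.              *)
Theorem theorem6p1 (F : fieldType) (P : lmodType F) :
  [/\ forall mul br : {bilinear P -> P -> P}, poisson mul br ->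
        (dedekind mul br <-> type_I mul br \/ type_II mul br),
      forall mul br : {bilinear P -> P -> P},
        commutative mul -> alternating br ->
        type_I mul br \/ type_II mul br ->
        poisson mul br /\ dedekind mul br,
      forall (E Z : set P) (e : P), decomposition_I E Z e ->
        exists mul br : {bilinear P -> P -> P},
          [/\ poisson mul br, dedekind mul br & table_I mul br Z e]
    & forall (E Z V : set P) (e c : P) (beta omega : P -> P -> F),
        decomposition_II E Z V e c -> forms_II V beta omega ->
        exists mul br : {bilinear P -> P -> P},
          [/\ poisson mul br, dedekind mul br
            & table_II mul br E Z V e c beta omega]].
Proof.
have conv (mul br : {bilinear P -> P -> P}) : commutative mul -> alternating br ->
    type_I mul br \/ type_II mul br -> poisson mul br /\ dedekind mul br.
  move=> mulC alt [[E [Z [e [dI tI]]]]|[E [Z [V [e [c [beta [omega [dII fII tII]]]]]]]]].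
    exact: table_I_dedekind mulC alt dI tI.
  exact: table_II_dedekind mulC alt dII fII tII.
split=> //; last exact: table_II_realised; last exact: table_I_realised.
move=> mul br poissonP; split=> [dedekindP|types].
  have [e ee e_unique] := exists_idempotent poissonP dedekindP.
  exact: (dedekind_type poissonP dedekindP ee e_unique).
by case: poissonP => mulC _ alt _ _; have [] := conv mul br mulC alt types.
Qed.
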